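(* There exist a completely regular scattered (and hence hereditarily Baire) topological space $X$ and a Baire-one function $f:X\to[0,1]$ which cannot be extended to a Baire-one function on the Stone–Čech compactification $\beta X$, i.e. there is no Baire-one function $g:\beta X\to\mathbb R$ with $g|_X=f$.
   Context: Completely regular spaces are assumed Hausdorff (Tychonoff). A map $f:X\to Y$ between topological spaces is Baire-one if it is the pointwise limit of a sequence of continuous maps $f_n:X\to Y$. A space is scattered if every nonempty subset $E$ has a point isolated in $E$. A space is hereditarily Baire if every closed subspace is a Baire space. *)

(* Defs.v *)
From HB Require Import structures.
From mathcomp Require Import all_boot all_order all_algebra.
From mathcomp Require Import all_classical all_reals all_analysis.
Import Order.TTheory GRing.Theory Num.Theory numFieldNormedType.Exports.

Set Implicit Arguments.
Unset Strict Implicit.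
Unset Printing Implicit Defensive.

Local Open Scope classical_set_scope.
Local Open Scope ring_scope.

Definition baire_one (X Y : topologicalType) (f : X -> Y) : Prop :=
  exists2 f_ : nat -> X -> Y, (forall n, continuous (f_ n)) &
    forall x, f_ n x @[n --> \oo] --> f x.

Definition scattered (X : topologicalType) : Prop :=
  forall E : set X, E !=set0 -> isolated E !=set0.

Definition baire_space (X : topologicalType) : Prop :=
  forall U : nat -> set X, (forall n, open (U n) /\ dense (U n)) ->
    dense (\bigcap_n U n).

(* [set_type A] carries the subspace topology. *)
Definition hereditarily_baire (X : topologicalType) : Prop :=
  forall A : set X, closed A -> baire_space (set_type A).

(* By [uniform_separatorP], [completely_regular_space] says that continuous
   [0,1]-valued functions separate points from closed sets. *)
Definition tychonoff_space (X : topologicalType) : Prop :=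
  completely_regular_space X /\ hausdorff_space X.

Definition unit_interval (R : realType) : topologicalType :=
  set_type (`[0, 1]%classic : set R).

(* The cube [0,1]^C(X,[0,1]), with the product topology. *)
Definition cube (R : realType) (X : topologicalType) : topologicalType :=
  prod_topology (fun _ : continuousType X (unit_interval R) => unit_interval R).

Definition cube_eval (R : realType) (X : topologicalType) (x : X) : cube R X :=
  fun h => h x.

Arguments cube_eval R {X} x.

(* beta X is the closure of the image of X under evaluation in the cube. *)
Definition stone_cech (R : realType) (X : topologicalType) : topologicalType :=
  set_type (closure (range (@cube_eval R X))).

Definition stone_cech_unit (R : realType) (X : topologicalType) (x : X) :
    stone_cech R X :=
  exist _ (cube_eval R x) (mem_set (subset_closure (imageT (@cube_eval R X) x))).

Arguments stone_cech_unit R {X} x.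

(* Main.v *)
Require Import Defs.
From HB Require Import structures.
From mathcomp Require Import all_boot all_order all_algebra.
From mathcomp Require Import all_classical all_reals all_analysis.
From mathcomp Require Import lra.
Import numFieldNormedType.Exports.
Import Order.TTheory GRing.Theory Num.Theory.

(** The obstruction is one of rank.  A Baire-one function on a compact space
    oscillates with a countable rank, so it suffices to find a scattered space
    carrying a Baire-one function whose oscillation rank is not countable.

    The space is a well-founded tree.  Its points are finite sequences of pairs
    (a, n), where the labels a are countably branching well-founded trees
    ([brouwer], a notation system for ordinals) and each label is a child of
    the one before.  Appending (a, n) to x gives points that converge to x as n
    tends to infinity.  The function [color] is the parity of the last n, so
    that next to every point both colors occur at once, with every label that
    can be appended.  Basic neighborhoods of x consist of extensions of x; as
    labels descend, every nonempty set contains a point without proper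
    extension in the set, which makes the space scattered
    ([tree_scattered]).  Erasing a sequence from the first n that is not below
    m on ([trunc] m) is locally constant and is eventually the identity as m
    grows, which makes [color] Baire-one ([tree_color_baire_one]).

    Suppose that continuous functions g_n on the tree converge to [color].
    Call an open set big when every label occurs in it.  The heart of the proof
    is [big_step]: if V is big, then for some n beyond any given bound the part
    of V where g_n is close to the color b is big again.  Otherwise each large n
    misses some label u n; the labels u n have a common strict upper bound
    [Sup u]; V contains a point of color b with this label, g_n is close to b
    at that point for some large n, hence also at nearby children, one of which
    has the label u n.  The regularity of the first uncountable ordinal is thus
    built into the constructor [Sup].  Iterating with alternating b yields
    indices n_0, n_1, ... such that all finite intersections of the sets where
    g_(n_k) is close to the parity of k are nonempty ([oscillating_chain]).  If
    the g_n extended to continuous functions converging pointwise on the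
    Stone-Cech compactification, compactness would give a point where the
    extensions are alternately near 0 and near 1: a contradiction
    ([tree_color_not_extendable]). *)

Set Implicit Arguments.
Unset Strict Implicit.
Unset Printing Implicit Defensive.

Local Open Scope classical_set_scope.
Local Open Scope ring_scope.

(** * Initial and product topologies, compactness *)

Lemma cvg_initial (S : choiceType) (T : topologicalType) (f : S -> T)
    (F : set_system S) (s : S) : Filter F ->
  f @ F --> f s -> F --> (s : initial_topology f).
Proof.
move=> FF cf A [_ [[B oB <-] Bfs] BA].
by apply: filterS BA _; apply: cf; exact: open_nbhs_nbhs.
Qed.

Lemma cvg_prod_topology (I : Type) (K : I -> topologicalType)
    (F : set_system (prod_topology K)) (p : prod_topology K) : Filter F ->
  (forall i, (fun q : prod_topology K => q i) @ F --> p i) -> F --> p.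
Proof.
move=> FF Fp; apply/cvg_sup => i.
exact: (@cvg_initial _ _ (fun q : forall j, K j => q i) F p FF (Fp i)).
Qed.

Lemma compact_set_type (T : topologicalType) (A : set T) :
  compact A -> compact [set: set_type A].
Proof.
move=> cA F PF _.
have FA : (set_val @ F) A.
  by apply: (@filterS _ F _ setT); [exact: (fun x _ => set_valP x)|exact: filterT].
have [p [Ap clp]] := cA _ _ FA.
exists (exist _ p (mem_set Ap)); split=> //.
move=> B C FB [_ [[D oD <-] Dp] DC].
have FB' : (set_val @ F) (set_val @` B).
  by apply: (@filterS _ F _ B); [move=> x Bx; exists x|exact: FB].
have Dp' : nbhs p D by exact: open_nbhs_nbhs.
have [_ [[x Bx <-] Dx]] := clp _ _ FB' Dp'.
by exists x; split=> //; exact: DC.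
Qed.

(** The isolated points of a scattered space are dense and belong to every
    dense set; scatteredness passes to subspaces. *)
Lemma scattered_hereditarily_baire (X : topologicalType) :
  scattered X -> hereditarily_baire X.
Proof.
move=> scX A _ U oU O [a Oa] oO.
have [|_ [/set_mem [x Ox <-] [V Vx VE]]] := scX (set_val @` O).
  by exists (set_val a); exists a.
exists x; split=> // n _.
have [_ Ud] := oU n.
pose P := O `&` (set_val @^-1` V°).
have [||y [[Oy /interior_subset Vy] Uy]] := Ud P.
- by exists x; split=> //; exact: Vx.
- apply: openI => //; apply: open_comp; last exact: open_interior.
  by move=> z _; exact: initial_continuous.
have : (V `&` set_val @` O) (set_val y) by split=> //; exists y.
by rewrite VE => /= /val_inj <-.
Qed.

Section stone_cech.
Context (R : realType).

Lemma compact_unit_interval : compact [set: unit_interval R].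
Proof. by apply: compact_set_type; exact: segment_compact. Qed.

Lemma stone_cech_compact (X : topologicalType) :
  compact [set: stone_cech R X].
Proof.
apply: compact_set_type; apply: subclosed_compact; first exact: closed_closure.
  apply: (@tychonoff {classic continuousType X (unit_interval R)}
    (fun=> unit_interval R) (fun=> setT)) => _; exact: compact_unit_interval.
by [].
Qed.

Lemma stone_cech_unit_continuous (X : topologicalType) :
  continuous (@stone_cech_unit R X).
Proof.
move=> x; apply: cvg_initial; apply: cvg_prod_topology => h.
exact: (@cts_fun _ _ h).
Qed.

End stone_cech.

(** * Labels and truncation of sequences *)

Inductive brouwer := Leaf | Sup of nat -> brouwer.

HB.instance Definition _ := gen_eqMixin brouwer.
HB.instance Definition _ := gen_choiceMixin brouwer.

Definition child (a b : brouwer) : Prop :=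
  if b is Sup u then exists n, a = u n else False.

(** Sequences are stored with their last entry first, so that appending an entry
    is [cons] and a proper extension of s is some r ++ s. *)
Definition desc (y z : brouwer * nat) : bool := `[< child y.1 z.1 >].

Definition node := {s : seq (brouwer * nat) | sorted desc s}.

(** The longest initial segment, in order of appending, whose indices are all
    below m. *)
Fixpoint trunc (m : nat) (s : seq (brouwer * nat)) :=
  if s is _ :: s' then if all (fun y => y.2 < m)%N s then s else trunc m s'
  else [::].

Lemma trunc_id m s : all (fun y => y.2 < m)%N s -> trunc m s = s.
Proof. by case: s => //= y s ->. Qed.

Lemma trunc_cons m y s : (m <= y.2)%N -> trunc m (y :: s) = trunc m s.
Proof. by move=> my /=; rewrite ltnNge my. Qed.

Lemma trunc_suffix m s : exists r, s = r ++ trunc m s.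
Proof.
elim: s => [|y s [r IH]]; first by exists [::].
rewrite /=; case: ifP => _; first by exists [::].
by exists (y :: r); rewrite {1}IH.
Qed.

Lemma trunc_eventually_id s : \forall m \near \oo, trunc m s = s.
Proof.
suff [M sM] : exists M, forall m, (M <= m)%N -> all (fun y => y.2 < m)%N s.
  by exists M => // m /= Mm; apply: trunc_id; exact: sM.
elim: s => [|y s [M IH]]; first by exists 0%N.
exists (maxn M y.2.+1) => m; rewrite geq_max => /andP[Mm ym] /=.
by rewrite ym IH.
Qed.

(** * The tree as a scattered space *)

Definition code (x : node) :
    prod_topology (fun _ : nat => discrete_topology (seq (brouwer * nat))) :=
  fun m => trunc m (val x).

(** An initial topology for a map into a power of a discrete space: the uniform
    structure, hence complete regularity, comes with it.  A basis of
    neighborhoods of x consists of the sets of all extensions of x whose first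
    new index is at least N, together with x itself. *)
Definition tree : uniformType := initial_topology code.

Definition seq_of (x : tree) : seq (brouwer * nat) := val (x : node).

(** The empty sequence gets the label [Leaf], which has no child: then
    [child a (label x)] ensures for every x that a may be appended to x. *)
Definition label (x : tree) : brouwer := (head (Leaf, 0%N) (seq_of x)).1.

Definition last_color (s : seq (brouwer * nat)) : bool :=
  odd (head (Leaf, 0%N) s).2.

Definition color (x : tree) : bool := last_color (seq_of x).

Lemma trunc_continuous m :
  continuous (fun x : tree =>
    trunc m (seq_of x) : discrete_topology (seq (brouwer * nat))).
Proof.
move=> x.
apply: (@continuous_comp _ _ _ (code : tree -> _) (@proj nat _ m)).
  exact: initial_continuous.
exact: proj_continuous.
Qed.

Lemma nbhs_trunc m (x : tree) :
  nbhs x [set y | trunc m (seq_of y) = trunc m (seq_of x)].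
Proof. exact: (trunc_continuous (discrete_set1 _)). Qed.

Lemma tree_hausdorff : hausdorff_space tree.
Proof.
move=> x y xy; apply: (val_inj : injective (val : node -> _)).
have [m [xm ym]] :
    exists m, trunc m (seq_of x) = seq_of x /\ trunc m (seq_of y) = seq_of y.
  have [m ?] := filter_ex (filterI (trunc_eventually_id (seq_of x))
    (trunc_eventually_id (seq_of y))).
  by exists m.
have [z [zx zy]] := xy _ _ (@nbhs_trunc m x) (@nbhs_trunc m y).
by rewrite -[LHS]xm -[RHS]ym -zx -zy.
Qed.

(** Otherwise sequences in E could be extended forever, and their labels would
    descend forever in the well-founded type [brouwer]. *)
Lemma exists_without_extension (E : set tree) (x0 : tree) : E x0 ->
  exists2 x, E x & forall y r, E y -> seq_of y = r ++ seq_of x -> r = [::].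
Proof.
move=> Ex0; apply: contrapT => nmax.
have grow x : E x -> exists2 y, E y &
    exists r z, seq_of y = r ++ z :: seq_of x.
  move=> Ex; apply: contrapT => ngrow; apply: nmax; exists x => // y r Ey.
  case/lastP: r => // r z; rewrite cat_rcons => yx.
  by exfalso; apply: ngrow; exists y => //; exists r, z.
have absurd a : forall n s r (y : tree), E y ->
    seq_of y = r ++ (a, n) :: s -> False.
  (* A second extension y' puts an entry (w, k) right after (a, n), and w is a
     child of a, to which the induction hypothesis applies. *)
  elim: a => [|u IH] n s r y /grow[y' Ey' [r' [z y'y]]] ys;
    rewrite ys -cat_rcons catA in y'y;
    case/lastP: (rcons r' z ++ r) y'y (size_cat (rcons r' z) r) => [|q [w k]];
    rewrite ?size_rcons ?addSn // cat_rcons => y'w _;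
    have := valP (y' : node); rewrite -/(seq_of y') y'w;
    move=> /cat_sorted2[_] /= /andP[/asboolP] //=.
  by move=> [l wl] _; apply: (IH l k _ q y' Ey'); rewrite y'w wl.
have [y Ey [r [[a n] yx]]] := grow _ Ex0.
exact: absurd Ey yx.
Qed.

Lemma tree_scattered : scattered tree.
Proof.
move=> E [x0 Ex0]; have [x Ex xmax] := exists_without_extension Ex0.
exists x; split; first exact: mem_set.
have [M _ xM] := trunc_eventually_id (seq_of x).
exists [set y | trunc M (seq_of y) = trunc M (seq_of x)].
  exact: nbhs_trunc.
apply/seteqP; split=> [y [/= yx Ey]|_ ->] //.
have [r yr] := trunc_suffix M (seq_of y).
rewrite yx (xM M) /= ?leqnn // in yr.
by apply: val_inj; rewrite -[LHS]/(seq_of y) yr (xmax _ _ Ey yr).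
Qed.

Lemma children_cvg (x : tree) a : child a (label x) ->
  exists2 c : nat -> tree, (forall n, seq_of (c n) = (a, n) :: seq_of x) &
    c n @[n --> \oo] --> x.
Proof.
move=> ax.
have cP n : sorted desc ((a, n) :: seq_of x).
  by case: x ax => -[|z s] //= zs az; rewrite zs andbT; apply/asboolP.
exists (fun n => (exist (fun s => sorted desc s) _ (cP n) : node) : tree) => //.
apply: cvg_initial; apply: cvg_prod_topology => m; apply/discrete_cvg.
by exists m => // n /= mn; rewrite /code trunc_cons.
Qed.

(** Along the children of x the parity of the index alternates, so both colors
    are found arbitrarily close to x. *)
Lemma open_child (V : set tree) x a b : open V -> V x -> child a (label x) ->
  exists y, [/\ V y, label y = a & color y = b].
Proof.
move=> oV Vx ax; have [c cE cx] := children_cvg ax.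
have [N _ cV] := cx V (open_nbhs_nbhs (conj oV Vx)).
exists (c (b + N.*2)%N); split.
- by apply: cV => /=; rewrite -addnn addnA leq_addl.
- by rewrite /label cE.
- by rewrite /color cE /last_color /= oddD odd_double addbF oddb.
Qed.

(** * Oscillation of approximating sequences *)

Definition big (V : set tree) : Prop :=
  open V /\ forall a, exists2 x, V x & label x = a.

Lemma big_setT : big setT.
Proof.
split=> [|a]; first exact: openT.
have xP : sorted desc [:: (a, 0%N)] by [].
by exists ((exist (fun s => sorted desc s) _ xP : node) : tree).
Qed.

Section oscillation.
Context (R : realType) (g : nat -> tree -> R).
Hypothesis g_cont : forall n, continuous (g n).
Hypothesis g_cvg : forall x, g n x @[n --> \oo] --> ((color x)%:R : R).

Definition close_to (b : bool) : set R := [set r | `|b%:R - r| < 3^-1].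

Lemma open_close_to b : open (close_to b).
Proof.
rewrite (_ : close_to b = ball (b%:R : R) 3^-1); first by apply: ball_open; lra.
by [].
Qed.

(** If every n >= N fails, each of them misses some label u n.  The label [Sup u]
    dominates all these labels at once, and at a point of color b carrying it
    the convergence of g forces one of them to be present. *)
Lemma big_step V N b : big V ->
  exists2 n, (N <= n)%N & big (V `&` g n @^-1` close_to b).
Proof.
move=> [oV Vbig]; apply: contrapT => nobig.
have oVn n : open (V `&` g n @^-1` close_to b).
  apply: openI => //; apply: (@open_comp _ _ (g n)); last exact: open_close_to.
  by move=> x _; exact: g_cont.
have /choice[u uP] n : exists a, (N <= n)%N ->
    forall x, V x -> close_to b (g n x) -> label x <> a.
  have [Nn|nN] := boolP (N <= n)%N; last by exists Leaf.
  apply: contrapT => na; apply: nobig; exists n => //; split=> // a.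
  apply: contrapT => nx; apply: na; exists a => _ x Vx gx xa.
  by apply: nx; exists x.
(* One more level above [Sup u], to choose the color of the point y that
   carries the label [Sup u]. *)
have [x Vx xl] := Vbig (Sup (fun=> Sup u)).
have [|y [Vy yl yb]] := @open_child V x (Sup u) b oV Vx.
  by rewrite xl; exists 0%N.
have yclose : close_to b (color y)%:R.
  by rewrite /close_to /= yb subrr normr0; lra.
have [M _ gM] := @g_cvg y _ (open_nbhs_nbhs (conj (@open_close_to b) yclose)).
pose n := maxn M N.
have [||z [[Vz gz] zl _]] := @open_child _ y (u n) b (oVn n).
- by split=> //; apply: gM; exact: leq_maxl.
- by rewrite yl; exists n.
exact: (uP n (leq_maxr _ _) z Vz gz zl).
Qed.

(** Iterates [big_step] from the whole tree; the state (V, k) also records the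
    step k, which prescribes the color and bounds the next index from below. *)
Lemma oscillating_chain : exists V : nat -> set tree, exists n : nat -> nat,
  forall k, [/\ V k !=set0, V k.+1 `<=` V k, (k <= n k)%N &
    V k.+1 `<=` g (n k) @^-1` close_to (odd k)].
Proof.
have /choice[F FP] (p : set tree * nat) : exists n, big p.1 ->
    (p.2 <= n)%N /\ big (p.1 `&` g n @^-1` close_to (odd p.2)).
  have [Vp|] := pselect (big p.1); last by exists 0%N.
  by have [n ? ?] := big_step p.2 (odd p.2) Vp; exists n.
pose V := fix V k := if k is k'.+1 then
  V k' `&` g (F (V k', k')) @^-1` close_to (odd k') else setT.
have Vbig k : big (V k).
  by elim: k => [|k /(FP (_, k))[]//]; exact: big_setT.
exists V, (fun k => F (V k, k)) => k.
have [/= kn _] := FP (V k, k) (Vbig k).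
split.
- by have [x Vx _] := (Vbig k).2 Leaf; exists x.
- by move=> x [].
- exact: kn.
- by move=> x [].
Qed.

End oscillation.

(** * A Baire-one function without Baire-one extension *)

Section tree_color.
Context (R : realType).

Definition unit_of_bool (b : bool) : unit_interval R.
Proof.
exists b%:R; apply/mem_set; rewrite /= in_itv /=.
by case: b; rewrite ?lexx ler01.
Defined.

Definition tree_color (x : tree) : unit_interval R := unit_of_bool (color x).

Lemma tree_color_baire_one : baire_one tree_color.
Proof.
exists (fun m x => unit_of_bool (last_color (trunc m (seq_of x)))) => [m x|x].
  apply: (@continuous_comp _ (discrete_topology (seq (brouwer * nat))) _
    (fun x : tree => trunc m (seq_of x)) (unit_of_bool \o last_color)).
    exact: trunc_continuous.
  by move=> A /nbhs_singleton Ay; apply: filterS (discrete_set1 _) => _ ->.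
apply: cvg_near_cst.
by apply: filterS (trunc_eventually_id (seq_of x)) => m /= ->.
Qed.

Lemma tree_color_not_extendable (g : stone_cech R tree -> R) :
  baire_one g -> ~ forall x, g (stone_cech_unit R x) = set_val (tree_color x).
Proof.
move=> [G G_cont G_cvg] gE.
have [||V [n VP]] := @oscillating_chain R (fun n x => G n (stone_cech_unit R x)).
- move=> k x; apply: (@continuous_comp _ _ _ (@stone_cech_unit R tree)).
    exact: stone_cech_unit_continuous.
  exact: G_cont.
- by move=> x; have := G_cvg (stone_cech_unit R x); rewrite gE.
have /choice[x xV] k : exists x, V k x by have [] := VP k.
have Vmono j k : (j <= k)%N -> V k `<=` V j.
  move=> /subnK <-; elim: (k - j)%N => // i IH y.
  by have [_ Vi _ _] := VP (i + j)%N; move=> /Vi/IH.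
have [p [_ clp]] := @stone_cech_compact R tree
  ((fun k => stone_cech_unit R (x k)) @ \oo) _ filterT.
have pclose k : `|(odd k)%:R - G (n k) p| <= 3^-1.
  pose C := [set q : stone_cech R tree | `|(odd k)%:R - G (n k) q| <= 3^-1].
  have clC : closed C.
    apply: (@closed_comp _ _ (fun q => `|(odd k)%:R - G (n k) q|)
      [set r | r <= 3^-1]).
      by move=> q _; exact: (cvg_norm (cvgB (cvg_cst _) (@G_cont (n k) q))).
    exact: closed_le.
  suff /clC : closure C p by [].
  suff CF : (stone_cech_unit R (x k) @[k --> \oo]) C.
    by move=> B pB; exact: clp CF pB.
  exists k.+1 => // j /= kj; apply: ltW.
  have [_ _ _] := VP k; apply; exact: (Vmono _ _ kj _ (xV j)).
(* 3^-1 + 6^-1 is a half, so g p would be less than a half away from both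
   0 and 1. *)
have gp6 : nbhs (g p) (ball (g p) (6^-1 : R)) by apply: nbhsx_ballx; lra.
have [M _ GM] := G_cvg p _ gp6.
have [_ _ n0 _] := VP M.*2; have [_ _ n1 _] := VP M.*2.+1.
have M2 : (M <= M.*2)%N by rewrite -addnn leq_addl.
have := pclose M.*2; have := pclose M.*2.+1.
have : `|g p - G (n M.*2) p| < 6^-1 := GM _ (leq_trans M2 n0).
have : `|g p - G (n M.*2.+1) p| < 6^-1 := GM _ (leq_trans (leqW M2) n1).
rewrite /= odd_double /= !ltr_norml !ler_norml.
move=> /andP[? ?] /andP[? ?] /andP[? ?] /andP[? ?]; lra.
Qed.

End tree_color.

Theorem theorem7 (R : realType) :
  exists (X : topologicalType) (f : X -> unit_interval R),
    [/\ tychonoff_space X, scattered X, hereditarily_baire X, baire_one f &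
      ~ exists g : stone_cech R X -> R,
          baire_one g /\ forall x : X, g (stone_cech_unit R x) = set_val (f x)].
Proof.
exists tree, (@tree_color R); split.
- by split; [exact: (@uniform_completely_regular R)|exact: tree_hausdorff].
- exact: tree_scattered.
- exact: scattered_hereditarily_baire tree_scattered.
- exact: tree_color_baire_one.
- by move=> [g [gB gE]]; exact: tree_color_not_extendable gB gE.
Qed.
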